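(* Let $n\geq 1$, $X_n=\{x_1,\dots,x_n\}$ a set with $n$ elements, and let ${}_{\mathcal{L}}\mathbf{SBIA}_n$ be the free left-handed skew Boolean intersection algebra over $X_n$. (1) There is a bijective correspondence between atoms of ${}_{\mathcal{L}}\mathbf{SBIA}_n$ and pointed partitions of non-empty subsets of $X_n$. (2) There is a bijective correspondence between atoms of ${}_{\mathcal{L}}\mathbf{SBIA}_n/\mathcal{D}$ and partitions of non-empty subsets of $X_n$.
   Context: A skew Boolean algebra (SBA) is an algebra $(S;\wedge,\vee,\setminus,0)$ of type $(2,2,2,0)$ satisfying: $\wedge$ and $\vee$ are associative; $x\vee(x\wedge y)=x=(y\wedge x)\vee x$ and $x\wedge(x\vee y)=x=(y\vee x)\wedge x$; $x\wedge(y\vee z)=(x\wedge y)\vee(x\wedge z)$ and $(y\vee z)\wedge x=(y\wedge x)\vee(z\wedge x)$; $x\vee 0=0\vee x=x$ and $x\wedge 0=0\wedge x=0$; $(x\setminus y)\wedge y=y\wedge(x\setminus y)=0$ and $(x\setminus y)\vee(x\wedge y\wedge x)=x=(x\wedge y\wedge x)\vee(x\setminus y)$; $x\wedge y\wedge z\wedge t=x\wedge z\wedge y\wedge t$. It is left-handed if also $x\wedge y\wedge x=x\wedge y$ and $x\vee y\vee x=y\vee x$. The natural partial order is: $x\leq y$ iff $x\wedge y=y\wedge x=x$. An SBA has intersections if any two elements $x,y$ have a greatest lower bound $x\sqcap y$ with respect to $\leq$; a (left-handed) skew Boolean intersection algebra (SBIA) is an algebra $(S;\wedge,\vee,\setminus,\sqcap,0)$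 where $(S;\wedge,\vee,\setminus,0)$ is a (left-handed) SBA with intersections and $\sqcap$ is this meet operation. Left-handed SBIAs form a variety in the signature $(\wedge,\vee,\setminus,\sqcap,0)$; free algebras are free algebras in this variety. The relation $\mathcal{D}$ is given by $x\mathrel{\mathcal{D}}y$ iff $x\wedge y\wedge x=x$ and $y\wedge x\wedge y=y$; it is a congruence on the reduct $(S;\wedge,\vee,\setminus,0)$, and $S/\mathcal{D}$ denotes the quotient of this reduct, which is a generalized Boolean algebra (a commutative SBA). An atom is a minimal non-zero element with respect to $\leq$. A partition of a set is a partition into non-empty blocks. A pointed partition of a non-empty subset of $X_n$ is a pair consisting of a partition $\alpha$ of a non-empty subset of $X_n$ and a chosen (marked) block $A\in\alpha$. *)

(* Defs.v *)
From HB Require Import structures.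
From mathcomp Require Import all_boot.
From mathcomp Require Import boolp classical_sets.

Set Implicit Arguments.
Unset Strict Implicit.
Unset Printing Implicit Defensive.

Declare Scope sba_scope.
Delimit Scope sba_scope with sba.

HB.mixin Record isSBA (S : Type) := {
  smeet : S -> S -> S;
  sjoin : S -> S -> S;
  sdiff : S -> S -> S;
  szero : S;
  smeetA : forall x y z, smeet x (smeet y z) = smeet (smeet x y) z;
  sjoinA : forall x y z, sjoin x (sjoin y z) = sjoin (sjoin x y) z;
  sjoinKr : forall x y, sjoin x (smeet x y) = x;
  sjoinKl : forall x y, sjoin (smeet y x) x = x;
  smeetKr : forall x y, smeet x (sjoin x y) = x;
  smeetKl : forall x y, smeet (sjoin y x) x = x;
  smeetDr : forall x y z, smeet x (sjoin y z) = sjoin (smeet x y) (smeet x z);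
  smeetDl : forall x y z, smeet (sjoin y z) x = sjoin (smeet y x) (smeet z x);
  sjoinx0 : forall x, sjoin x szero = x;
  sjoin0x : forall x, sjoin szero x = x;
  smeetx0 : forall x, smeet x szero = szero;
  smeet0x : forall x, smeet szero x = szero;
  sdiffK : forall x y, smeet (sdiff x y) y = szero;
  sdiffKC : forall x y, smeet y (sdiff x y) = szero;
  sdiff_meet : forall x y, sjoin (sdiff x y) (smeet (smeet x y) x) = x;
  smeet_diff : forall x y, sjoin (smeet (smeet x y) x) (sdiff x y) = x;
  smeet_normal : forall x y z t,
    smeet (smeet (smeet x y) z) t = smeet (smeet (smeet x z) y) t
}.

#[short(type="sbaType")]
HB.structure Definition SBA := { S of isSBA S }.

Arguments szero {s}.

Notation "x `&` y" := (smeet x y) : sba_scope.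
Notation "x `|` y" := (sjoin x y) : sba_scope.
Notation "x `\` y" := (sdiff x y) : sba_scope.
Notation "0" := (@szero _) : sba_scope.

Local Open Scope sba_scope.

Definition natle (S : sbaType) (x y : S) : Prop := x `&` y = x /\ y `&` x = x.

Notation "x <= y" := (natle x y) : sba_scope.

Definition atoms (S : sbaType) : set S :=
  fun a => a <> 0 /\ forall b : S, b <> 0 -> b <= a -> b = a.
Arguments atoms S : clear implicits.

HB.mixin Record hasIntersections (S : Type) of SBA S := {
  scap : S -> S -> S;
  scap_lel : forall x y : S, scap x y <= x;
  scap_ler : forall x y : S, scap x y <= y;
  scap_glb : forall x y z : S, z <= x -> z <= y -> z <= scap x y
}.

#[short(type="sbiaType")]
HB.structure Definition SBIA := { S of SBA S & hasIntersections S }.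

HB.mixin Record isLeftHanded (S : Type) of SBA S := {
  smeet_lh : forall x y : S, x `&` y `&` x = x `&` y;
  sjoin_lh : forall x y : S, x `|` y `|` x = y `|` x
}.

#[short(type="lsbiaType")]
HB.structure Definition LSBIA := { S of SBIA S & isLeftHanded S }.

Record sbia_hom (S T : sbiaType) (h : S -> T) : Prop := SbiaHom {
  sbia_homI : forall x y, h (x `&` y) = h x `&` h y;
  sbia_homU : forall x y, h (x `|` y) = h x `|` h y;
  sbia_homD : forall x y, h (x `\` y) = h x `\` h y;
  sbia_homC : forall x y, h (scap x y) = scap (h x) (h y);
  sbia_hom0 : h 0 = 0
}.

Definition free_lsbia (X : Type) (S : lsbiaType) (g : X -> S) : Prop :=
  forall (T : lsbiaType) (f : X -> T),
    exists! h : S -> T, sbia_hom h /\ forall x, h (g x) = f x.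

Definition sbaD (S : sbaType) (x y : S) : Prop :=
  x `&` y `&` x = x /\ y `&` x `&` y = y.

Section DCongruence.
Variable S : sbaType.
Implicit Types x y z t a b : S.

Lemma smeetxx x : x `&` x = x.
Proof. by rewrite -{2}(sjoinKr x x) smeetKr. Qed.

Lemma smeetxxA x y : x `&` (x `&` y) = x `&` y.
Proof. by rewrite smeetA smeetxx. Qed.

Lemma smeetACm x y z t : x `&` (y `&` (z `&` t)) = x `&` (z `&` (y `&` t)).
Proof. by rewrite !smeetA smeet_normal. Qed.

Lemma sbaD_refl x : sbaD x x.
Proof. by split; rewrite !smeetxx. Qed.

Lemma sbaD_sym x y : sbaD x y -> sbaD y x.
Proof. by case. Qed.

Lemma sbaD_trans y x z : sbaD x y -> sbaD y z -> sbaD x z.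
Proof.
have half a b c : sbaD a b -> sbaD b c -> a `&` c `&` a = a.
  move=> [ab _] [bc _].
  have acba : a `&` (c `&` (b `&` a)) = a.
    by rewrite -{3}ab -{2}bc -!smeetA (smeetACm a b c) smeetxxA.
  by rewrite -[RHS]acba -{2}ab -!smeetA (smeetACm a c a) smeetxxA.
move=> xy yz; split; first exact: half xy yz.
by apply: half (sbaD_sym yz) (sbaD_sym xy).
Qed.

Lemma sbaD_meet x x' y y' :
  sbaD x x' -> sbaD y y' -> sbaD (x `&` y) (x' `&` y').
Proof.
have half a a' b b' : sbaD a a' -> sbaD b b' ->
    a `&` b `&` (a' `&` b') `&` (a `&` b) = a `&` b.
  move=> [aa' _] [bb' _].
  rewrite -[RHS](_ : a `&` a' `&` a `&` (b `&` b' `&` b) = _); last by rewrite aa' bb'.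
  by rewrite -!smeetA (smeetACm a b a') (smeetACm b b' a) (smeetACm a' b a).
move=> xx yy; split; first exact: half.
by apply: half; apply: sbaD_sym.
Qed.

Lemma sbaD_join x x' y y' :
  sbaD x x' -> sbaD y y' -> sbaD (x `|` y) (x' `|` y').
Proof.
have half a a' b b' : sbaD a a' -> sbaD b b' ->
    (a `|` b) `&` (a' `|` b') `&` (a `|` b) = a `|` b.
  move=> [aa' _] [bb' _].
  set s := a `|` b; set s' := a' `|` b'; set e := s `&` s' `&` s.
  have ae : a `&` e = a.
    have asa : a `&` s' `&` a = a.
      by rewrite /s' smeetDr smeetDl aa' -smeetA sjoinKr.
    by rewrite /e !smeetA smeetKr (smeetDr (a `&` s')) asa -smeetA sjoinKr.
  have eb : e `&` b = b.
    have bsb : b `&` s' `&` b = b.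
      by rewrite /s' smeetDr smeetDl bb' sjoinKl.
    rewrite /e -!smeetA smeetKl smeetDl smeetA; rewrite [b `&` _]smeetA bsb.
    by rewrite sjoinKl.
  have se : s `&` e = e by rewrite /e -!smeetA smeetxxA.
  have es : e `&` s = e by rewrite /e -!smeetA smeetxx.
  set d := s `\` e.
  have de : d `&` e = 0 by exact: sdiffK.
  have sE : d `|` e = s by rewrite -[RHS](sdiff_meet s e) se es.
  have ds : d `&` s = d by rewrite -sE smeetKr.
  have da : d `&` a = 0.
    rewrite -ae -(smeetxx e) (smeetACm d a e e).
    by rewrite (smeetA d e) de smeet0x.
  have db : d `&` b = 0 by rewrite -eb smeetA de smeet0x.
  have d0 : d = 0 by rewrite -ds /s smeetDr da db sjoinx0.
  by rewrite -sE d0 sjoin0x.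
move=> xx yy; split; first exact: half.
by apply: half; apply: sbaD_sym.
Qed.

Lemma sbaD_diff x x' y y' :
  sbaD x x' -> sbaD y y' -> sbaD (x `\` y) (x' `\` y').
Proof.
have half a a' b b' : sbaD a a' -> sbaD b b' ->
    (a `\` b) `&` (a' `\` b') `&` (a `\` b) = a `\` b.
  move=> [aa' _] [_ bb'].
  set d := a `\` b; set d' := a' `\` b'.
  have da : d `&` a = d by rewrite -{1}(sdiff_meet a b) smeetKr.
  have ad : a `&` d = d by rewrite -{1}(smeet_diff a b) smeetKl.
  have db : d `&` b = 0 by exact: sdiffK.
  have dd : d `&` a' `&` d = d.
    rewrite -{1}da -{2}ad.
    rewrite (_ : _ `&` _ = d `&` (a `&` a' `&` a) `&` d); last by rewrite -!smeetA.
    by rewrite aa' da smeetxx.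
  rewrite -[RHS]dd -{1}(sdiff_meet a' b') smeetDr smeetDl -/d'.
  rewrite (_ : d `&` (a' `&` b' `&` a') `&` d = 0) ?sjoinx0 //.
  rewrite -bb' -!smeetA (smeetACm a' b' b) (smeetACm d a' b).
  by rewrite smeetA db smeet0x.
move=> xx yy; split; first exact: half.
by apply: half; apply: sbaD_sym.
Qed.

End DCongruence.

Section DQuotient.
Variable S : sbaType.
Local Open Scope quotient_scope.

Let Drel : rel {classic S} := fun x y => `[< sbaD (x : S) y >].

Let Drel_refl : reflexive Drel.
Proof. by move=> x; apply/asboolP; exact: sbaD_refl. Qed.

Let Drel_sym : symmetric Drel.
Proof. by move=> x y; apply/asboolP/asboolP; exact: sbaD_sym. Qed.

Let Drel_trans : transitive Drel.
Proof.
by move=> y x z /asboolP xy /asboolP yz; apply/asboolP; exact: sbaD_trans yz.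
Qed.

Canonical Dequiv := EquivRel Drel Drel_refl Drel_sym Drel_trans.

(* The quotient S / D of the reduct (S; meet, join, diff, 0). The alias
   {classic S} only supplies the choiceType structure {eq_quot _} asks for. *)
Definition Dquot : Type := {eq_quot Dequiv}.

Definition Dclass (x : S) : Dquot := \pi_{eq_quot Dequiv} (x : {classic S}).

Lemma DclassP x y : Dclass x = Dclass y <-> sbaD x y.
Proof.
split=> [xy|xy]; first by apply/asboolP; apply/(eqmodP Dequiv).
by apply/(eqmodP Dequiv)/asboolP.
Qed.

Let rp (A : Dquot) : S := repr (A : {eq_quot Dequiv}).

Let rpK A : Dclass (rp A) = A.
Proof. exact: reprK. Qed.

Let rpD x : sbaD (rp (Dclass x)) x.
Proof. by apply/DclassP; rewrite rpK. Qed.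

Definition Dmeet (A B : Dquot) : Dquot := Dclass (rp A `&` rp B).
Definition Djoin (A B : Dquot) : Dquot := Dclass (rp A `|` rp B).
Definition Ddiff (A B : Dquot) : Dquot := Dclass (rp A `\` rp B).

Lemma DmeetE x y : Dmeet (Dclass x) (Dclass y) = Dclass (x `&` y).
Proof. by apply/DclassP; apply: sbaD_meet. Qed.

Lemma DjoinE x y : Djoin (Dclass x) (Dclass y) = Dclass (x `|` y).
Proof. by apply/DclassP; apply: sbaD_join. Qed.

Lemma DdiffE x y : Ddiff (Dclass x) (Dclass y) = Dclass (x `\` y).
Proof. by apply/DclassP; apply: sbaD_diff. Qed.

Lemma Dclass_surj (A : Dquot) : exists x, A = Dclass x.
Proof. by exists (rp A); rewrite rpK. Qed.

Local Ltac lift lem :=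
  repeat (let A := fresh in move=> A; have [? ->] := Dclass_surj A; clear A);
  rewrite ?(DmeetE, DjoinE, DdiffE); congr Dclass; exact: lem.

Fact Dquot_isSBA : isSBA Dquot.
Proof.
apply: (@isSBA.Build Dquot Dmeet Djoin Ddiff (Dclass 0)).
- lift (@smeetA S).
- lift (@sjoinA S).
- lift (@sjoinKr S).
- lift (@sjoinKl S).
- lift (@smeetKr S).
- lift (@smeetKl S).
- lift (@smeetDr S).
- lift (@smeetDl S).
- lift (@sjoinx0 S).
- lift (@sjoin0x S).
- lift (@smeetx0 S).
- lift (@smeet0x S).
- lift (@sdiffK S).
- lift (@sdiffKC S).
- lift (@sdiff_meet S).
- lift (@smeet_diff S).
- lift (@smeet_normal S).
Defined.

HB.instance Definition _ := Dquot_isSBA.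

End DQuotient.

Section SetPartitions.
Variable X : finType.

(* finset.partition requires the blocks to be non-empty. *)
Definition subset_partitions : {set {set {set X}}} :=
  [set P | [exists Y : {set X}, (Y != finset.set0) && finset.partition P Y]].

Definition pointed_subset_partitions : {set {set {set X}} * {set X}} :=
  [set p | (p.1 \in subset_partitions) && (p.2 \in p.1)].

End SetPartitions.

(* Main.v *)
(* An atom [a] yields the retraction [y |-> y `&` a] of [S] onto its D-class
   together with 0, and the D-class is exhausted by the [g x `&` a]. The kernel
   of [x |-> g x `&` a] on the generators with [g x `&` a <> 0] is the partition
   attached to [a], and the block [g x `&` a = a] is the marked one.
   A non-zero element [a] is an atom as soon as each [scap (g x) (g y)] either
   annihilates it or absorbs it. Hence two orthogonal atoms cannot have the same
   partition, because their join would be an atom too. Conversely, a pointed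
   partition gives a homomorphism from [S] to the primitive algebra on its
   blocks; cutting a generator of the marked block by the finitely many
   [scap (g x) (g y)] or by their complements produces an atom. *)
Require Import Defs.
From HB Require Import structures.
From mathcomp Require Import all_boot.
From mathcomp Require Import boolp classical_sets functions.

Set Implicit Arguments.
Unset Strict Implicit.
Unset Printing Implicit Defensive.

Local Open Scope sba_scope.

(** * Subalgebras and induction over the generators of a free algebra *)

Record subuniverse (S : sbiaType) (U : S -> Prop) : Prop := Subuniverse {
  subuniverseI : forall x y, U x -> U y -> U (x `&` y);
  subuniverseU : forall x y, U x -> U y -> U (x `|` y);
  subuniverseD : forall x y, U x -> U y -> U (x `\` y);
  subuniverseC : forall x y, U x -> U y -> U (scap x y);
  subuniverse0 : U 0
}.

(** The closure proof [hU] is a parameter of the type, so that the algebra structure can be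
    recovered from the type alone. *)
Definition subalgebra (S : sbiaType) (U : S -> Prop) (hU : subuniverse U) :=
  {y : S | U y}.

Section Subalgebra.
Variables (S : lsbiaType) (U : S -> Prop) (hU : subuniverse U).
Implicit Types x y : subalgebra hU.

Lemma subalgebra_val_inj x y : sval x = sval y -> x = y.
Proof. by case: x y => [x Ux] [y Uy] /= xy; exact: eq_exist. Qed.

Definition sub_meet x y : subalgebra hU :=
  exist _ (sval x `&` sval y) (subuniverseI hU (svalP x) (svalP y)).
Definition sub_join x y : subalgebra hU :=
  exist _ (sval x `|` sval y) (subuniverseU hU (svalP x) (svalP y)).
Definition sub_diff x y : subalgebra hU :=
  exist _ (sval x `\` sval y) (subuniverseD hU (svalP x) (svalP y)).
Definition sub_cap x y : subalgebra hU :=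
  exist _ (scap (sval x) (sval y)) (subuniverseC hU (svalP x) (svalP y)).
Definition sub_zero : subalgebra hU := exist _ 0 (subuniverse0 hU).

Fact subalgebra_isSBA : isSBA (subalgebra hU).
Proof.
apply: (@isSBA.Build _ sub_meet sub_join sub_diff sub_zero);
  intros; apply: subalgebra_val_inj => /=.
- exact: smeetA.
- exact: sjoinA.
- exact: sjoinKr.
- exact: sjoinKl.
- exact: smeetKr.
- exact: smeetKl.
- exact: smeetDr.
- exact: smeetDl.
- exact: sjoinx0.
- exact: sjoin0x.
- exact: smeetx0.
- exact: smeet0x.
- exact: sdiffK.
- exact: sdiffKC.
- exact: sdiff_meet.
- exact: smeet_diff.
- exact: smeet_normal.
Defined.

HB.instance Definition _ := subalgebra_isSBA.

Lemma subalgebra_natle x y : x <= y <-> sval x <= sval y.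
Proof.
split=> [[xy yx]|[xy yx]]; split; try exact: subalgebra_val_inj.
  by rewrite -[in RHS]xy.
by rewrite -[in RHS]yx.
Qed.

Fact subalgebra_hasIntersections : hasIntersections (subalgebra hU).
Proof.
apply: (@hasIntersections.Build _ sub_cap) => [x y|x y|x y z].
- by apply/subalgebra_natle; exact: scap_lel.
- by apply/subalgebra_natle; exact: scap_ler.
- by move=> /subalgebra_natle zx /subalgebra_natle zy;
    apply/subalgebra_natle; exact: scap_glb.
Defined.

HB.instance Definition _ := subalgebra_hasIntersections.

Fact subalgebra_isLeftHanded : isLeftHanded (subalgebra hU).
Proof.
by split=> x y; apply: subalgebra_val_inj; [exact: smeet_lh|exact: sjoin_lh].
Qed.

HB.instance Definition _ := subalgebra_isLeftHanded.

End Subalgebra.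

(** Freeness gives a homomorphism from [S] to the subalgebra on [U]. Followed by the inclusion it
    fixes the generators, so by uniqueness it is the identity. *)
Lemma free_lsbia_ind (X : Type) (S : lsbiaType) (g : X -> S) (U : S -> Prop) :
  free_lsbia g -> subuniverse U -> (forall x, U (g x)) -> forall y, U y.
Proof.
move=> free_g hU Ug y.
have [h [[h_hom hg] _]] := free_g (subalgebra hU) (fun x => exist _ (g x) (Ug x)).
have [k [_ k_unique]] := free_g S g.
have h_val : k = (fun z => sval (h z)).
  apply: k_unique; split=> [|x]; last by rewrite hg.
  by split=> *; rewrite ?(sbia_homI h_hom, sbia_homU h_hom, sbia_homD h_hom,
    sbia_homC h_hom, sbia_hom0 h_hom).
have k_id : k = id by apply: k_unique.
by rewrite -[y]/(id y) -k_id h_val; exact: svalP.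
Qed.

(* The primitive left-handed algebra with D-classes [T] and [{0}]; [None] is 0. *)
Definition primitive (T : Type) := option T.

(** * Primitive left-handed algebras *)

Section Primitive.
Variable T : eqType.
Implicit Types x y : primitive T.

Definition prim_meet x y : primitive T := if y is Some _ then x else None.
Definition prim_join x y : primitive T := if y is Some _ then y else x.
Definition prim_diff x y : primitive T := if y is Some _ then None else x.
(** The natural order is flat, so distinct elements have only 0 as a common lower bound. *)
Definition prim_cap x y : primitive T := if x == y :> option T then x else None.

Fact primitive_isSBA : isSBA (primitive T).
Proof.
apply: (@isSBA.Build _ prim_meet prim_join prim_diff None);
  abstract (by repeat case=> [?|]).
Defined.

HB.instance Definition _ := primitive_isSBA.

Fact primitive_hasIntersections : hasIntersections (primitive T).
Proof.
apply: (@hasIntersections.Build _ prim_cap) => x y.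
- abstract (by rewrite /prim_cap; case: eqP => _; split; case: x).
- abstract (by rewrite /prim_cap; case: eqP => [->|_]; split; case: y).
- move=> z zx zy; abstract (move: z zx zy => [z|] [_ zx] [_ zy];
    [rewrite (_ : x = Some z) // (_ : y = Some z) // /prim_cap eqxx|];
    by split=> //; case: (prim_cap x y)).
Defined.

HB.instance Definition _ := primitive_hasIntersections.

Fact primitive_isLeftHanded : isLeftHanded (primitive T).
Proof. by split; abstract (by move=> [x|] [y|]). Qed.

HB.instance Definition _ := primitive_isLeftHanded.

End Primitive.

(** * Order, intersections and atoms in a left-handed algebra *)

Section LeftHanded.
Variable S : lsbiaType.
Implicit Types a b x y z : S.

(** Normality only permutes inner factors; left-handedness makes [y] and [z] inner by appending a
    second copy of [x]. *)
Lemma smeetAC x y z : x `&` y `&` z = x `&` z `&` y.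
Proof.
by rewrite -!smeetA -[LHS]smeet_lh -[RHS]smeet_lh !smeetA smeet_normal.
Qed.

Lemma natleP x y : x <= y <-> y `&` x = x.
Proof. by split=> [[]//|yx]; split=> //; rewrite -yx smeet_lh. Qed.

Lemma natle_anti x y : x <= y -> y <= x -> x = y.
Proof. by move=> [xy _] [_ yx]; rewrite -[LHS]xy. Qed.

Lemma natle_trans y x z : x <= y -> y <= z -> x <= z.
Proof.
by move=> /natleP yx /natleP zy; apply/natleP; rewrite -yx smeetA zy.
Qed.

Lemma smeet_natle x y : x `&` y <= x.
Proof. by apply/natleP; exact: smeetxxA. Qed.

Lemma sdiff_natle x y : x `\` y <= x.
Proof. by apply/natleP; rewrite -{1}(smeet_diff x y) smeetKl. Qed.

Lemma natle_meet2r a x y : x <= y -> x `&` a <= y `&` a.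
Proof.
by move=> /natleP yx; apply/natleP; rewrite smeetA (smeetAC y) yx -smeetA smeetxx.
Qed.

Lemma smeet_eq0C x y : x `&` y = 0 -> y `&` x = 0.
Proof. by move=> xy; rewrite -smeet_lh -smeetA xy smeetx0. Qed.

Lemma scapxx x : scap x x = x.
Proof.
by apply: natle_anti; [exact: scap_lel|apply: scap_glb; split; exact: smeetxx].
Qed.

Lemma scap0x x : scap 0 x = 0.
Proof. by have [_] := scap_lel (0 : S) x; rewrite smeet0x. Qed.

Lemma scapx0 x : scap x 0 = 0.
Proof. by have [_] := scap_ler x (0 : S); rewrite smeet0x. Qed.

(** One inequality is monotonicity of $z \mapsto z\wedge a$. For the other, the right-hand side $w$
    lies below [x] and [y] and satisfies $w = w\wedge a$. *)
Lemma smeet_scapl a x y : scap x y `&` a = scap (x `&` a) (y `&` a).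
Proof.
apply: natle_anti.
  by apply: scap_glb; apply: natle_meet2r; [exact: scap_lel|exact: scap_ler].
set w := scap _ _; have wx : w <= x `&` a := scap_lel _ _.
have wa : w `&` a = w by have [<- _] := wx; rewrite -!smeetA smeetxx.
rewrite -wa; apply: natle_meet2r; apply: scap_glb; apply: natle_trans.
- exact: wx.
- exact: smeet_natle.
- exact: scap_ler.
- exact: smeet_natle.
Qed.

Lemma sdiff_eq0r x y a : y `&` a = 0 -> (x `\` y) `&` a = x `&` a.
Proof.
move=> ya; rewrite -{2}(sdiff_meet x y) smeetDl smeet_lh -smeetA ya smeetx0.
by rewrite sjoinx0.
Qed.

Lemma sdiff_absorb x y a : a `&` y = a -> (x `\` y) `&` a = 0.
Proof. by move=> <-; rewrite smeetA smeetAC sdiffK smeet0x. Qed.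

(** In $S/\mathcal{D}$, the class of [a] is disjoint from that of [y] or contained in it. *)
Definition decides a y := a `&` y = 0 \/ a `&` y = a.

Lemma decides_natle a b y : b <= a -> decides a y -> decides b y.
Proof.
move=> [<- _] [ay|ay]; [left|right]; rewrite -smeetA ay //.
exact: smeetx0.
Qed.

(** Write $d$ for the intersection. For any $z\geq d$, $z\wedge a = z\wedge a\wedge d = z\wedge
    d\wedge a = d\wedge a$. *)
Lemma smeet_scap_absorb a x y :
  a `&` scap x y = a -> scap x y `&` a = x `&` a /\ scap x y `&` a = y `&` a.
Proof.
set d := scap x y => ad.
have absorb z : d <= z -> d `&` a = z `&` a.
  by move=> [_ zd]; rewrite -[in RHS]ad smeetA smeetAC zd.
by split; apply: absorb; [exact: scap_lel|exact: scap_ler].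
Qed.

Lemma decides_scap a x y : decides a (scap x y) ->
  scap x y `&` a = 0 \/ scap x y `&` a = x `&` a /\ x `&` a = y `&` a.
Proof.
move=> [/smeet_eq0C|/smeet_scap_absorb [dx dy]]; first by left.
by right; rewrite -dx -dy.
Qed.

Lemma atom_decides a y : atoms S a -> decides a y.
Proof.
move=> [_ a_min]; have [ay|ay] := EM (a `&` y = 0); [by left|right].
by apply: a_min => //; exact: smeet_natle.
Qed.

Lemma atom_absorb a y : atoms S a -> y `&` a <> 0 -> a `&` y = a.
Proof. by move=> /(atom_decides y) [/smeet_eq0C|]. Qed.

(** This turns an equality of values in the D-class of [a] into the non-vanishing of an
    intersection, which homomorphisms can detect. *)
Lemma atom_scap a x y : atoms S a -> x `&` a <> 0 ->
  scap x y `&` a <> 0 <-> x `&` a = y `&` a.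
Proof.
move=> at_a xa; split=> [d|xy].
  by have [|[]] := decides_scap (atom_decides (scap x y) at_a).
by rewrite smeet_scapl -xy scapxx.
Qed.

Lemma sbaD_smeet a b : sbaD a b <-> a `&` b = a /\ b `&` a = b.
Proof. by rewrite /sbaD !smeet_lh. Qed.

Lemma atom_sbaD a b : atoms S a -> atoms S b -> a `&` b <> 0 -> sbaD a b.
Proof.
move=> at_a at_b ab; apply/sbaD_smeet; split; last exact: atom_absorb.
by apply: atom_absorb => // /smeet_eq0C.
Qed.

Lemma sbaD_smeet_eq a b x y : sbaD a b -> x `&` a = y `&` a -> x `&` b = y `&` b.
Proof.
by move=> /sbaD_smeet [_ ba] xy; rewrite -ba !smeetA !(smeetAC _ b) xy.
Qed.

(** $a = a\wedge b = x\wedge a\wedge b = x\wedge b\wedge a = b\wedge a = b$. With [x] a generator of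
    the marked block, this singles out one atom in a D-class. *)
Lemma sbaD_natle_inj a b x : sbaD a b -> a <= x -> b <= x -> a = b.
Proof.
move=> /sbaD_smeet [ab ba] /natleP xa /natleP xb.
by rewrite -ab -{1}xa smeetAC xb ba.
Qed.

Lemma sbaD0 x : sbaD x 0 -> x = 0.
Proof. by case=> <- _; rewrite smeetx0 smeet0x. Qed.

Lemma Dclass_natle x y : x <= y -> Dclass x <= Dclass y.
Proof. by case=> xy yx; split; rewrite [LHS]DmeetE ?xy ?yx. Qed.

(** An element below [x] and D-equivalent to [x] is [x] itself. Conversely, a class below that of
    [x] has the representative $x\wedge b\leq x$. *)
Lemma atoms_Dclass x : atoms (Dquot S) (Dclass x) <-> atoms S x.
Proof.
split=> [[x0 x_min]|[x0 x_min]].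
  split=> [xE|b b0 bx]; first by apply: x0; rewrite xE.
  have /DclassP/sbaD_smeet [bxE xbE] : Dclass b = Dclass x.
    apply: x_min; last exact: Dclass_natle.
    by move=> /DclassP/sbaD0.
  by case: bx => _; rewrite xbE.
split=> [/DclassP/sbaD0//|B].
have [b ->] := Dclass_surj B => b0 [_ xb].
have xbE : Dclass (x `&` b) = Dclass b by rewrite -DmeetE.
rewrite -xbE (x_min (x `&` b)) //; last exact: smeet_natle.
by move=> xb0; apply: b0; rewrite -xbE xb0.
Qed.

End LeftHanded.

(** * Atoms of a free algebra *)

Section FreeAtoms.
Variables (X : Type) (S : lsbiaType) (g : X -> S).
Hypothesis free_g : free_lsbia g.
Implicit Types a b y z : S.

(* [scapxx] makes this cover the generators themselves. *)
Definition decides_generators a := forall x x', decides a (scap (g x) (g x')).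

(** Induction on [y]. The clause on $a\wedge g\,x$ is carried along because it forces $a\wedge y =
    a$, needed for meets and differences. The hypothesis on [a] enters at generators and
    intersections. *)
Lemma decides_generators_meet a y : decides_generators a ->
  y `&` a = 0 \/ exists2 x, y `&` a = g x `&` a & a `&` g x = a.
Proof.
move=> dec_a.
pose U y := y `&` a = 0 \/ exists2 x, y `&` a = g x `&` a & a `&` g x = a.
suff hU : subuniverse U.
  apply: (free_lsbia_ind free_g hU) => x.
  have := dec_a x x; rewrite scapxx => -[/smeet_eq0C|agx]; first by left.
  by right; exists x.
have absorb z x : z `&` a = g x `&` a -> a `&` g x = a -> a `&` z = a.
  by move=> za agx; rewrite -smeet_lh -smeetA za smeetA smeet_lh.
split=> [y1 y2 Uy1 [y2a|[x2 y2a ag2]]|y1 y2 Uy1 Uy2|y1 y2 Uy1 [y2a|[x2 y2a ag2]]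
    |y1 y2 Uy1 Uy2|].
- by left; rewrite -smeetA y2a smeetx0.
- by rewrite /U smeetAC -smeetA (absorb _ _ y2a ag2).
- rewrite /U smeetDl.
  case: Uy1 Uy2 => [->|[x1 y1a ag1]]; first by rewrite sjoin0x.
  move=> [->|[x2 y2a ag2]]; first by rewrite sjoinx0; right; exists x1.
  (* Here $y_1\wedge a$ equals $(y_1\wedge a)\wedge(g\,x_2\wedge a)$, so by absorption the join
     collapses to its right operand. *)
  right; exists x2 => //; rewrite y2a -[RHS](sjoinKl _ (y1 `&` a)); congr (_ `|` _).
  by rewrite smeetA -(smeetA y1) ag2 -smeetA smeetxx.
- by rewrite /U sdiff_eq0r.
- by left; apply: sdiff_absorb; exact: absorb ag2.
- rewrite /U smeet_scapl.
  case: Uy1 Uy2 => [->|[x1 -> ag1]]; first by rewrite scap0x; left.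
  move=> [->|[x2 -> ag2]]; first by rewrite scapx0; left.
  rewrite -smeet_scapl; have [->|[-> _]] := decides_scap (dec_a x1 x2).
    by left.
  by right; exists x1.
- by left; rewrite smeet0x.
Qed.

(** A non-zero $b\leq a$ has the form $g\,x\wedge a$ with $a\wedge g\,x = a$, whence $b = a\wedge b
    = a\wedge g\,x\wedge a = a$. Over finitely many generators, being an atom thus becomes a finite
    list of conditions. *)
Lemma atomsP a : atoms S a <-> a <> 0 /\ decides_generators a.
Proof.
split=> [at_a|[a0 dec_a]].
  by split=> [|x x']; [case: at_a|exact: atom_decides].
split=> // b b0 [ba ab]; have := decides_generators_meet b dec_a.
rewrite ba => -[//|[x bE agx]].
by rewrite -ab bE smeetA smeet_lh.
Qed.

Lemma atom_generator a y : atoms S a -> y `&` a <> 0 ->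
  exists x, y `&` a = g x `&` a.
Proof.
move=> /atomsP [_ /(decides_generators_meet y)] [//|[x yx _] _].
by exists x.
Qed.

(* Were [a] and [b] orthogonal, their join would be an atom above both. *)
Lemma same_kernel_sbaD a b : atoms S a -> atoms S b ->
  (forall x, g x `&` a = 0 <-> g x `&` b = 0) ->
  (forall x x', g x `&` a <> 0 -> g x' `&` a <> 0 ->
    g x `&` a = g x' `&` a <-> g x `&` b = g x' `&` b) ->
  sbaD a b.
Proof.
move=> at_a at_b supp_ab ker_ab; apply: atom_sbaD => // ab0.
have ba0 := smeet_eq0C ab0.
have ac : a <= a `|` b by apply/natleP; rewrite smeetDl smeetxx ba0 sjoinx0.
have bc : b <= a `|` b by apply/natleP; rewrite smeetDl smeetxx ab0 sjoin0x.
have [[a0 _] [b0 _]] := (at_a, at_b).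
suff [_ c_min] : atoms S (a `|` b).
  have aE := c_min a a0 ac; have bE := c_min b b0 bc.
  by apply: a0; rewrite -(smeetxx a) {2}aE -bE.
apply/atomsP; split=> [c0|x y].
  by case: ac => _ /esym; rewrite c0 smeet0x.
set d := scap _ _.
have dP e : atoms S e -> d `&` e <> 0 <-> g x `&` e <> 0 /\ g x `&` e = g y `&` e.
  move=> at_e; split=> [de|[xe xy]]; last by apply/atom_scap.
  suff xe : g x `&` e <> 0 by split=> //; apply/(atom_scap (g y) at_e xe).
  by move=> xe; apply: de; rewrite smeet_scapl xe scap0x.
(* Whether [d] annihilates an atom depends only on the support and kernel of that atom, so [d]
   treats [a] and [b] alike and their join is decided. *)
have dab : d `&` a <> 0 <-> d `&` b <> 0.
  split=> /dP-/(_ _)[]// xe xy; apply/dP => //.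
    split; first by rewrite -supp_ab.
    by rewrite -ker_ab // -xy.
  rewrite -supp_ab in xe; split=> //; apply/ker_ab => //.
  by move/supp_ab; rewrite -xy => /supp_ab.
rewrite /decides smeetDl.
have [da|/[dup] da /dab db] := EM (d `&` a = 0); last first.
  by right; rewrite (atom_absorb at_a da) (atom_absorb at_b db).
have db : d `&` b = 0 by apply: contrapT => /dab.
by left; rewrite (smeet_eq0C da) (smeet_eq0C db) sjoinx0.
Qed.

End FreeAtoms.

(** * Homomorphisms to a primitive algebra *)

Section PrimitiveHom.
Variables (S : lsbiaType) (T : eqType) (h : S -> primitive T).
Hypothesis h_hom : sbia_hom h.
Implicit Types a y z : S.

Lemma prim_hom_meetl a y : h a <> 0 -> h (y `&` a) = h y.
Proof. by rewrite (sbia_homI h_hom) => ha; case: (h a) ha. Qed.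

Lemma prim_hom_neq0 a : h a <> 0 -> a <> 0.
Proof. by move=> ha aE; apply: ha; rewrite aE (sbia_hom0 h_hom). Qed.

Lemma prim_hom_scap y z : h y = h z -> h (scap y z) = h y.
Proof. by move=> yz; rewrite (sbia_homC h_hom) yz scapxx. Qed.

(** Each [d i] in turn replaces [b] by $b\setminus d_i$ if [h] kills [d i], and by $b\wedge d_i$
    otherwise. Both keep the value under [h], and going down preserves earlier decisions. *)
Lemma prim_hom_refine (I : eqType) (d : I -> S) (s : seq I) a : h a <> 0 ->
  exists2 b, h b = h a & forall i, i \in s -> decides b (d i).
Proof.
move=> ha; elim: s => [|i s [b hb dec_b]]; first by exists a.
suff [c hc [cb dec_c]] : exists2 c, h c = h b & c <= b /\ decides c (d i).
  exists c => [|j]; first by rewrite hc.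
  rewrite inE => /predU1P [->//|js].
  by apply: decides_natle cb _; exact: dec_b.
have [hd|hd] := EM (h (d i) = 0).
  exists (b `\` d i); first by rewrite (sbia_homD h_hom) hd.
  by split; [exact: sdiff_natle|left; exact: sdiffK].
exists (b `&` d i); first exact: prim_hom_meetl.
split; first exact: smeet_natle.
by right; rewrite -smeetA smeetxx.
Qed.

Variable a : S.
Hypotheses (at_a : atoms S a) (ha : h a <> 0).

Lemma prim_hom_atom_eq0 y : y `&` a = 0 <-> h y = 0.
Proof.
split=> [ya|hy]; first by rewrite -(prim_hom_meetl y ha) ya (sbia_hom0 h_hom).
apply: contrapT => /(atom_absorb at_a) ay.
by apply: ha; rewrite -ay (sbia_homI h_hom) hy smeetx0.
Qed.

(** Thus [h] and the retraction $y\mapsto y\wedge a$ have the same kernel. If [h] agrees on [y] and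
    [z] with a non-zero value, it does not kill their intersection, so neither does [a], and
    [atom_scap] applies. *)
Lemma prim_hom_atom_eq y z : y `&` a = z `&` a <-> h y = h z.
Proof.
split=> [yz|hyz].
  by rewrite -(prim_hom_meetl y ha) yz prim_hom_meetl.
have [ya|ya] := EM (y `&` a = 0).
  by rewrite ya; apply/esym/prim_hom_atom_eq0; rewrite -hyz; apply/prim_hom_atom_eq0.
apply/(atom_scap z at_a ya); rewrite prim_hom_atom_eq0 prim_hom_scap //.
by rewrite -prim_hom_atom_eq0.
Qed.

End PrimitiveHom.

Lemma eq_preim_partition (T : finType) (rT rT' : eqType) (f : T -> rT)
    (f' : T -> rT') (D : {set T}) :
  {in D &, forall x y, (f x == f y) = (f' x == f' y)} ->
  preim_partition f D = preim_partition f' D.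
Proof.
move=> ff'; apply: eq_in_imset => x Dx; apply/setP => y; rewrite !inE.
by case: (boolP (y \in D)) => //= Dy; rewrite ff'.
Qed.

(** * The pointed partition of an atom *)

Section AtomPartition.
Variables (X : finType) (S : lsbiaType) (g : X -> S).
Hypothesis free_g : free_lsbia g.
Implicit Types a b : S.

Definition atom_support a : {set X} := [set x | `[< g x `&` a <> 0 >]].

(** The alias [{classic S}] only supplies the decidable equality that [preim_partition] asks for. *)
Definition atom_partition a : {set {set X}} :=
  preim_partition (fun x => (g x `&` a : {classic S})) (atom_support a).

(** By [natleP], these are the generators above [a]. *)
Definition atom_block a : {set X} := [set x | `[< g x `&` a = a >]].

Lemma atom_supportP a x : reflect (g x `&` a <> 0) (x \in atom_support a).
Proof. by rewrite inE; exact: asboolP. Qed.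

Lemma atom_blockP a x : reflect (g x `&` a = a) (x \in atom_block a).
Proof. by rewrite inE; exact: asboolP. Qed.

Lemma atom_partitionP a :
  finset.partition (atom_partition a) (atom_support a).
Proof. exact: preim_partitionP. Qed.

Lemma mem_pblock_atom a x y : x \in atom_support a -> y \in atom_support a ->
  y \in finset.pblock (atom_partition a) x <-> g x `&` a = g y `&` a.
Proof.
move=> ax ay; rewrite /atom_partition /preim_partition.
rewrite pblock_equivalence_partition //=; first by split=> [/eqP|->].
by move=> x1 x2 x3 _ _ _ /=; split=> // /eqP ->.
Qed.

Lemma atom_block_neq0 a : atoms S a -> exists x, x \in atom_block a.
Proof.
move=> at_a; have [a0 _] := at_a; rewrite -(smeetxx a) in a0.
have [x ax] := atom_generator free_g at_a a0.
by exists x; apply/atom_blockP; rewrite -ax smeetxx.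
Qed.

Lemma atom_block_subset a : atoms S a -> atom_block a \subset atom_support a.
Proof.
move=> [a0 _]; apply/fintype.subsetP => x /atom_blockP xa; apply/atom_supportP.
by rewrite xa.
Qed.

Lemma atom_pointed_partition a : atoms S a ->
  (atom_partition a, atom_block a) \in pointed_subset_partitions X.
Proof.
move=> at_a; have [x ax] := atom_block_neq0 at_a.
have sx := fintype.subsetP (atom_block_subset at_a) x ax.
rewrite inE /= inE; apply/andP; split.
  apply/existsP; exists (atom_support a); rewrite atom_partitionP andbT.
  by apply/set0Pn; exists x.
(* The block of [x] is the fibre over $g\,x\wedge a$, which is [a] by the choice of [x]. *)
apply/imsetP; exists x => //; apply/setP => y; rewrite [in RHS]inE /=.
apply/atom_blockP/andP => [ya|[_ /eqP <-]]; last exact/atom_blockP.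
split; last by rewrite ya (atom_blockP _ _ ax).
by apply: (fintype.subsetP (atom_block_subset at_a)); exact/atom_blockP.
Qed.

(** D-equivalent elements induce the same kernel. Conversely, the cover of the partition recovers
    the support and its blocks recover the kernel, so [same_kernel_sbaD] applies. *)
Lemma atom_partition_sbaD a b : atoms S a -> atoms S b ->
  sbaD a b <-> atom_partition a = atom_partition b.
Proof.
move=> at_a at_b; split=> [Dab|Pab].
  have Kab x y : x `&` a = y `&` a <-> x `&` b = y `&` b.
    by split; apply: sbaD_smeet_eq => //; exact: sbaD_sym.
  have sab : atom_support a = atom_support b.
    (* Comparing with 0 turns equality of values into vanishing. *)
    apply/setP => x; have := Kab (g x) 0; rewrite !smeet0x => xab.
    by apply/atom_supportP/atom_supportP => + /xab.
  rewrite /atom_partition sab; apply: eq_preim_partition => x y _ _.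
  by apply/eqP/eqP => /Kab.
have sab : atom_support a = atom_support b.
  rewrite -(cover_partition (atom_partitionP a)) Pab.
  exact: cover_partition (atom_partitionP b).
apply: same_kernel_sbaD => // [x|x y /atom_supportP sx /atom_supportP sy].
  split=> xe; apply: contrapT => /atom_supportP; first rewrite -sab.
    by move/atom_supportP.
  by rewrite sab => /atom_supportP.
by rewrite -mem_pblock_atom // Pab mem_pblock_atom -?sab.
Qed.

(** Equal partitions put both atoms in one D-class, and a generator from the common marked block
    lies above both. *)
Lemma atom_pointed_partition_inj a b : atoms S a -> atoms S b ->
  atom_partition a = atom_partition b -> atom_block a = atom_block b -> a = b.
Proof.
move=> at_a at_b /atom_partition_sbaD-/(_ at_a at_b) Dab Aab.
have [x xa] := atom_block_neq0 at_a; have xb := xa; rewrite Aab in xb.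
by apply: (sbaD_natle_inj (x := g x)) => //; apply/natleP;
  [exact/atom_blockP|exact/atom_blockP].
Qed.

Lemma atom_of_pointed_partition P A : P \in subset_partitions X -> A \in P ->
  exists a, [/\ atoms S a, atom_partition a = P & atom_block a = A].
Proof.
rewrite inE => /existsP [Y /andP [_ partP]] PA.
have tiP := partition_trivIset partP.
have P0 : finset.set0 \notin P by case/and3P: partP.
(* Each generator goes to its block, and those outside the underlying subset go to 0. *)
pose h0 x : primitive {set X} :=
  if x \in finset.cover P then Some (finset.pblock P x) else None.
have [h [[h_hom hg] _]] := free_g h0.
have h0P x B : h0 x = Some B <-> x \in B /\ B \in P.
  rewrite /h0; split=> [|[xB PB]].
    by case: ifP => // xP [<-]; rewrite finset.mem_pblock pblock_mem.
  by rewrite (_ : x \in _) ?(def_pblock tiP PB) //; apply/finset.bigcupP; exists B.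
have [x0 Ax0] : exists x, x \in A.
  by apply/set0Pn; apply: contraNneq P0 => <-.
have hx0 : h (g x0) = Some A by rewrite hg; apply/h0P.
have hx0_neq0 : h (g x0) <> 0 by rewrite hx0.
(* Refining a generator of [A] keeps the value [Some A], which is what makes [A] the marked
   block. *)
have [a ha dec_a] := prim_hom_refine h_hom (fun p : X * X => scap (g p.1) (g p.2))
  (enum {: X * X}) hx0_neq0.
rewrite {}hx0 in ha; have ha_neq0 : h a <> 0 by rewrite ha.
have at_a : atoms S a.
  apply/(atomsP free_g); split; first exact: prim_hom_neq0 ha_neq0.
  by move=> x y; apply: (dec_a (x, y)); rewrite mem_enum.
exists a; split=> //.
- rewrite -[RHS](preim_partition_pblock partP) -(cover_partition partP).
  rewrite /atom_partition.
  have -> : atom_support a = finset.cover P.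
    apply/setP => x; apply/atom_supportP/idP => [|xP].
      by rewrite (prim_hom_atom_eq0 h_hom) // hg /h0; case: ifP.
    by rewrite (prim_hom_atom_eq0 h_hom) // hg /h0 xP.
  apply: eq_preim_partition => x y xP yP.
  apply/eqP/eqP => [/(prim_hom_atom_eq h_hom at_a ha_neq0)|xy].
    by rewrite !hg /h0 xP yP => -[].
  by apply/(prim_hom_atom_eq h_hom at_a ha_neq0); rewrite !hg /h0 xP yP xy.
- apply/setP => x; apply/atom_blockP/idP => [xa|xA].
    have : h (g x) = h a.
      by apply/(prim_hom_atom_eq h_hom at_a ha_neq0); rewrite smeetxx.
    by rewrite hg ha => /h0P[].
  rewrite -[RHS]smeetxx; apply/(prim_hom_atom_eq h_hom at_a ha_neq0).
  by rewrite hg ha; apply/h0P.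
Qed.

End AtomPartition.

Theorem corollary26 (n : nat) (hn : (1 <= n)%N)
    (X : finType) (hX : #|X| = n)
    (S : lsbiaType) (g : X -> S) (hfree : free_lsbia g) :
  (exists f : S -> {set {set X}} * {set X},
      set_bij (atoms S) [set` pointed_subset_partitions X]%classic f) /\
  (exists f : Dquot S -> {set {set X}},
      set_bij (atoms (Dquot S)) [set` subset_partitions X]%classic f).
Proof.
split.
  exists (fun a => (atom_partition g a, atom_block g a)); split.
  - by move=> a /(atom_pointed_partition hfree).
  - by move=> a b /set_mem at_a /set_mem at_b [];
      exact: atom_pointed_partition_inj.
  - move=> [P A] /=; rewrite inE => /andP [PX PA].
    have [a [at_a aP aA]] := atom_of_pointed_partition hfree PX PA.
    by exists a => //; rewrite aP aA.
(* The representative is an arbitrary choice; by [atom_partition_sbaD] the partition of an atom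
   depends only on its D-class. *)
pose r (B : Dquot S) : S := sval (cid (Dclass_surj B)).
have rK B : Dclass (r B) = B by rewrite /r; case: cid.
have at_r B : atoms (Dquot S) B -> atoms S (r B).
  by move=> at_B; apply/atoms_Dclass; rewrite rK.
exists (fun B => atom_partition g (r B)); split.
- move=> B /at_r /(atom_pointed_partition hfree).
  by rewrite inE => /andP[].
- move=> B C /set_mem/at_r at_B /set_mem/at_r at_C PBC.
  rewrite -[LHS]rK -[RHS]rK; apply/DclassP.
  exact/(atom_partition_sbaD hfree).
- move=> P /= PX.
  (* Any block may serve as the marked one, since passing to D-classes forgets the mark. *)
  have [A PA] : exists A, A \in P.
    have := PX; rewrite inE => /existsP [Y /andP [/set0Pn [x Yx] partP]].
    exists (finset.pblock P x); apply: pblock_mem.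
    by rewrite (cover_partition partP).
  have [a [at_a aP _]] := atom_of_pointed_partition hfree PX PA.
  have at_Da : atoms (Dquot S) (Dclass a) by apply/atoms_Dclass.
  exists (Dclass a) => //; rewrite -aP; apply/(atom_partition_sbaD hfree) => //.
    exact: at_r.
  by apply/DclassP; rewrite rK.
Qed.
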